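(* Suppose that $(S, \preceq)$ is a uniform poset, and let $\boldsymbol{X}$ be an upward run chain on $S$ with transition function $P$. Then: (i) $F(x) = P^n(e,x)$ for $x \in S_n$, $n \in \mathbb{N}$; (ii) $\mathbb{P}_e(T_e > n) = P^n(e, S_n)$ for $n \in \mathbb{N}$, and $\boldsymbol{X}$ is recurrent if and only if $P^n(e,S_n) \to 0$ as $n \to \infty$; (iii) $\boldsymbol{X}$ is positive recurrent if and only if $\mu(e) = \mathbb{E}_e(T_e) = \sum_{n=0}^\infty P^n(e,S_n)$ is finite, and in this case the invariant probability density function is $f(x) = P^n(e,x)/\mu(e)$ for $x \in S_n$, $n \in \mathbb{N}$.
   Context: $(S, \preceq)$ is a discrete (countable) partially ordered set with a minimum element $e$, such that for every $x \in S$ every chain (totally ordered subset) in $S$ from $e$ to $x$ is finite. An element $y$ covers $x$ if $y$ is a minimal element of $\{t \in S : t \succ x\}$; $A_x = \{y \in S : y \text{ covers } x\}$. The covering graph is the directed graph on $S$ with an edge $(x,y)$ whenever $y$ covers $x$. The poset is uniform if for each $x \in S$ all directed paths from $e$ to $x$ in the covering graph have the same length, denoted $d(e,x)$; $S_n = \{x \in S : d(e,x) = n\}$ for $n \in \mathbb{N} = \{0,1,2,\ldots\}$. An upward run chain is a (time-homogeneous, discrete-time) Markov chain $(X_0, X_1, \ldots)$ on $S$ whose transition function $P$ satisfies $P(x,y) > 0$ if and only if $y \in A_x$ or $y = e$. $P^n$ is the $n$-step transition function and $P^n(e,A) = \sum_{x \in A} P^n(e,x)$. $\mathbb{P}_e$,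 $\mathbb{E}_e$ denote probability and expectation given $X_0 = e$; $T_x = \min\{n \ge 1 : X_n = x\}$ (with $\min\emptyset=\infty$). $F(e) = 1$ and $F(x) = \mathbb{P}_e(T_x < T_e)$ for $x \ne e$. *)

(* Defs.v *)
From HB Require Import structures.
From mathcomp Require Import all_boot all_order all_algebra.
From mathcomp Require Import all_classical all_reals all_analysis.

Set Implicit Arguments.
Unset Strict Implicit.
Unset Printing Implicit Defensive.

Import Order.TTheory GRing.Theory Num.Theory.

Local Open Scope classical_set_scope.
Local Open Scope ring_scope.

(* The minimum element e of the poset is \bot. *)
Section Poset.
Context {disp : Order.disp_t} {S : bPOrderType disp}.
Implicit Types x y t : S.
Local Open Scope order_scope.

Definition finite_chains : Prop :=
  forall (x : S) (C : set S),
    total_on C (fun a b : S => a <= b) ->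
    C \bot -> C x -> (forall y, C y -> \bot <= y <= x) ->
    finite_set C.

(* y is a minimal element of [set t | x < t] *)
Definition covers x y : Prop := x < y /\ forall t, x < t -> ~ (t < y).

Definition upper_covers x : set S := [set y | covers x y].

(* p lists the vertices after the initial one, so its size is the number of
   edges of the path. *)
Definition cover_path x (p : seq S) y : Prop :=
  path (fun a b : S => `[< covers a b >]) x p /\ last x p = y.

Definition uniform : Prop :=
  forall x (p q : seq S),
    cover_path \bot p x -> cover_path \bot q x -> size p = size q.

(* d(e, x); under finite_chains some path from e to x exists, and under uniform
   its length is unique, so the default 0 is not used. *)
Definition dist_bot x : nat :=
  xget 0%N [set n | exists p : seq S, cover_path \bot p x /\ size p = n].

Definition level (n : nat) : set S := [set x | dist_bot x = n].

End Poset.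

Arguments finite_chains {disp} S.
Arguments uniform {disp} S.
Arguments level {disp S} n.

Section Transition.
Context {R : realType} {S : choiceType}.
Implicit Types (P : S -> S -> R) (x y : S).
Local Open Scope ereal_scope.

Definition transition_function P : Prop :=
  (forall x y, (0 <= P x y)%R) /\
  (forall x, \esum_(y in [set: S]) (P x y)%:E = 1).

Fixpoint nstep P (n : nat) x y : \bar R :=
  if n is m.+1 then \esum_(z in [set: S]) (P x z)%:E * nstep P m z y
  else (x == y)%:R%:E.

Definition nstep_set P (n : nat) x (A : set S) : \bar R :=
  \esum_(y in A) nstep P n x y.

Definition invariant_pdf P (f : S -> R) : Prop :=
  [/\ forall x, (0 <= f x)%R,
      \esum_(x in [set: S]) (f x)%:E = 1
    & forall y, \esum_(x in [set: S]) (f x)%:E * (P x y)%:E = (f y)%:E].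

End Transition.

Definition upward_run {R : realType} {disp : Order.disp_t}
    {S : bPOrderType disp} (P : S -> S -> R) : Prop :=
  transition_function P /\
  forall x y : S, 0 < P x y <-> (upper_covers x y \/ y = \bot%O).

Section Chain.
Context {R : realType} {S : choiceType} {d : measure_display}
  {Omega : measurableType d}.
Implicit Types (P : S -> S -> R) (X : nat -> Omega -> S)
  (Pr : S -> probability Omega R) (x y : S).
Local Open Scope ereal_scope.

(* Pr x is the law given X_0 = x.  S is countable and discrete, so measurability
   of X_n is measurability of its fibers; the last field is
   P(X_{n+1} = y | X_0 = s_0, ..., X_n = s_n) = P(s_n, y), multiplied out so as
   to be void when the conditioning event is null. *)
Record markov_chain P X Pr : Prop := MarkovChain {
  chain_measurable : forall n x, measurable (X n @^-1` [set x]);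
  chain_start : forall x, Pr x (X 0%N @^-1` [set x]) = 1;
  chain_markov : forall x (n : nat) (s : nat -> S) y,
    Pr x ([set w | forall i, (i <= n)%N -> X i w = s i] `&`
          X n.+1 @^-1` [set y]) =
    Pr x [set w | forall i, (i <= n)%N -> X i w = s i] * (P (s n) y)%:E
}.

(* T_x, with value +oo if x is not visited at any time n >= 1 *)
Definition hitting_time X x (w : Omega) : \bar R :=
  ereal_inf [set (n%:R)%:E | n in [set n : nat | (1 <= n)%N /\ X n w = x]].

Definition mean_return X Pr x : \bar R := \int[Pr x]_w hitting_time X x w.

Definition recurrent X Pr : Prop :=
  forall x, Pr x [set w | hitting_time X x w < +oo] = 1.

Definition positive_recurrent X Pr : Prop :=
  forall x, mean_return X Pr x < +oo.

End Chain.

(* the function F; its value at e is 1 by convention *)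
Definition hit_prob {R : realType} {disp : Order.disp_t} {S : bPOrderType disp}
    {d : measure_display} {Omega : measurableType d}
    (X : nat -> Omega -> S) (Pr : S -> probability Omega R) (x : S) : \bar R :=
  if x == \bot%O then 1%E
  else Pr \bot%O
    [set w | (hitting_time X x w < hitting_time X \bot%O w :> \bar R)%E].

(* Main.v *)
Require Import Defs.
From HB Require Import structures.
From mathcomp Require Import all_boot all_order all_algebra.
From mathcomp Require Import all_classical all_reals all_analysis.
From mathcomp Require Import lra measurable_realfun.

Set Implicit Arguments.
Unset Strict Implicit.
Unset Printing Implicit Defensive.

Import Order.TTheory GRing.Theory Num.Theory numFieldNormedType.Exports.

Local Open Scope classical_set_scope.
Local Open Scope ring_scope.
Local Open Scope ereal_scope.

(** In a uniform poset an edge of the covering graph raises the level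
    d(e, x) by exactly one, and every other transition of an upward run chain
    goes to e.  Started at e, the chain is therefore at level n at time n if
    and only if it has not yet returned to e, and it can be at a state of level
    n before its first return at time n only.  In terms of kernels: killing P
    at its visits to e turns P^n(e, .) into its restriction to level n
    ([taboo_bot_level]).  The formula for F, that for the tail of T_e and, by
    summing the tail, that for E_e(T_e) follow ([hitting_time_gtE],
    [hit_before_bigcup], [mean_return_series]).

    Recurrence and positive recurrence at e have to be carried over to every
    other state y.  Both are handled by the truncated means
    m_y^N(x) = E_x(min(T_y, N)), the sums of the first N tails P_x(T_y > n).
    As e and y communicate, m_y^N(y) <= C m_e^N(e) with a constant C that does
    not depend on N ([truncated_mean_return_bot]).  Letting N tend to infinity
    gives E_y(T_y) <= C E_e(T_e).  Dividing by N first shows that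
    P_y(T_y > n) tends to 0 when P_e(T_e > n) does, since the tails decrease
    and their averages converge to the same limit ([survival_cvg0]).

    For the invariant density let F(x) = P^d(e,x)(e, x).  If f is invariant,
    the balance equation at a state of level n + 1 involves the states of level
    n only, so f = f(e) F by induction on the level, and the total mass fixes
    f(e) ([invariant_pdf_unique]).  Conversely F satisfies the balance equation
    at every state other than e, and the equation at e follows because P
    preserves the finite total mass ([invariant_pdf_density]). *)

(** * Sums of nonnegative families *)

Section esum_extra.
Context {R : realType}.

Lemma ge0_esumZl (T : choiceType) (I : set T) (r : R) (a : T -> \bar R) :
  (0 <= r)%R -> (forall i, 0 <= a i) ->
  \esum_(i in I) (r%:E * a i) = r%:E * \esum_(i in I) a i.
Proof.
move=> r0 a0; rewrite /esum -ereal_supZl//; last first.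
  by apply/set0P; exists 0, set0; [exact: fsets_set0|rewrite fsbig_set0].
congr ereal_sup; apply/seteqP; split=> [x [A IA <-]|x [_ [A IA <-] <-]].
  by exists (\sum_(i \in A) a i); [exists A|rewrite ge0_mule_fsumr].
by exists A => //; rewrite ge0_mule_fsumr.
Qed.

Lemma esum_exchange (T1 T2 : choiceType) (a : T1 -> T2 -> \bar R) :
  (forall i j, 0 <= a i j) ->
  \esum_(i in [set: T1]) \esum_(j in [set: T2]) a i j =
  \esum_(j in [set: T2]) \esum_(i in [set: T1]) a i j.
Proof.
move=> a0; rewrite !esum_esum//.
rewrite (@reindex_esum _ _ _ ([set: T2] `*`` (fun=> [set: T1])) _
  (fun k => (k.2, k.1)))//.
by split=> // [[i j] [i' j'] _ _ [-> ->]//|[i j] _]; exists (j, i).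
Qed.

Lemma esum_single (T : choiceType) (a : T -> \bar R) y :
  (forall z, z != y -> a z = 0) -> 0 <= a y ->
  \esum_(z in [set: T]) a z = a y.
Proof.
move=> az ay; have a0 z : 0 <= a z by have [->//|/az->] := eqVneq z y.
rewrite (esumID [set y])// setTI esum_set1// esum1 ?adde0// => z [_ /eqP/=].
exact: az.
Qed.

Lemma esumD1 (T : choiceType) (a : T -> \bar R) y :
  (forall z, 0 <= a z) ->
  \esum_(z in [set: T]) a z =
  a y + \esum_(z in [set: T]) (if z == y then 0 else a z).
Proof.
move=> a0; transitivity (\esum_(z in [set: T])
    ((if z == y then a z else 0) + (if z == y then 0 else a z))).
  by apply: eq_esum => z _; case: ifP; rewrite ?adde0 ?add0e.
rewrite esumD; [|by move=> z _; case: ifP..].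
by rewrite (@esum_single _ _ y)/= ?eqxx// => z /negPf ->.
Qed.

End esum_extra.

(** * Kernels killed at a state *)

Section kernel.
Context {R : realType} {S : choiceType}.
Implicit Types (K : S -> S -> R) (x y z : S) (A : set S).

Lemma nstep_ge0 K n x y : (forall x y, (0 <= K x y)%R) -> 0 <= nstep K n x y.
Proof.
move=> K0; elim: n x => [|n IH] x /=; first by rewrite lee_fin.
by apply: esum_ge0 => z _; rewrite mule_ge0 ?lee_fin.
Qed.

Lemma nstepS K n x y :
  nstep K n.+1 x y = \esum_(z in [set: S]) (K x z)%:E * nstep K n z y.
Proof. by []. Qed.

(** The n-step function is defined by its first step; this is the decomposition
    at the last one. *)
Lemma nstepSr K n x y : (forall x y, (0 <= K x y)%R) ->
  nstep K n.+1 x y = \esum_(z in [set: S]) nstep K n x z * (K z y)%:E.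
Proof.
move=> K0; elim: n x => [|n IH] x.
  rewrite nstepS /= (@esum_single _ _ _ y); last 2 first.
  - by move=> z /negPf ->; rewrite mule0.
  - by rewrite eqxx mule1 lee_fin.
  rewrite (@esum_single _ _ _ x) ?eqxx ?mul1e ?mule1//.
  - by move=> z; rewrite eq_sym => /negPf ->; rewrite mul0e.
  - by rewrite lee_fin.
have n0 := nstep_ge0 _ _ _ K0.
rewrite nstepS.
transitivity (\esum_(z in [set: S]) \esum_(w in [set: S])
    ((K x z)%:E * (nstep K n z w * (K w y)%:E))).
  apply: eq_esum => z _; rewrite IH ge0_esumZl// => i.
  by rewrite mule_ge0 ?lee_fin.
rewrite esum_exchange; last first.
  by move=> i j; rewrite !mule_ge0 ?lee_fin.
apply: eq_esum => w _ /=; rewrite muleC -ge0_esumZl//; last first.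
  by move=> i; rewrite mule_ge0 ?lee_fin.
by apply: eq_esum => z _; rewrite muleA muleC.
Qed.

(** The kernel with the transitions into y removed: its n-step function is
    the law of X_n on the event that y is not visited at times 1, ..., n. *)
Definition taboo K y : S -> S -> R := fun x z => if z == y then 0%R else K x z.

Lemma taboo_ge0 K y x z : (forall x y, (0 <= K x y)%R) -> (0 <= taboo K y x z)%R.
Proof. by move=> K0; rewrite /taboo; case: ifP. Qed.

(** The probability P_x(T_y > n): the total mass left after n steps when the
    kernel is killed at y. *)
Definition survival K y n x : \bar R := nstep_set (taboo K y) n x [set: S].

(** The expectation E_x(min(T_y, N)), as a sum of tails; all terms are at most 1
    for a transition function, so [fine] loses nothing. *)
Definition truncated_mean K y N x : R := fine (\sum_(n < N) survival K y n x).

End kernel.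

Section transition.
Context {R : realType} {S : choiceType} (P : S -> S -> R).
Hypothesis Ptr : transition_function P.
Implicit Types (x y z e : S).

Let P0 x y : (0 <= P x y)%R. Proof. by case: Ptr. Qed.
Let P1 x : \esum_(y in [set: S]) (P x y)%:E = 1. Proof. by case: Ptr. Qed.
#[local] Hint Resolve P0 : core.

Lemma survival0 y x : survival P y 0 x = 1.
Proof.
rewrite /survival /nstep_set (@esum_single _ _ _ x) /= ?eqxx//.
by move=> z; rewrite eq_sym => /negPf ->.
Qed.

Lemma survivalS y n x : survival P y n.+1 x =
  \esum_(z in [set: S]) (taboo P y x z)%:E * survival P y n z.
Proof.
have Q0 a b := @taboo_ge0 _ _ P y a b P0.
rewrite /survival /nstep_set /= esum_exchange; last first.
  by move=> i j; rewrite mule_ge0 ?lee_fin ?nstep_ge0.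
by apply: eq_esum => z _; rewrite ge0_esumZl// => w; exact: nstep_ge0.
Qed.

Lemma survival_ge0 y n x : 0 <= survival P y n x.
Proof.
by apply: esum_ge0 => z _; apply: nstep_ge0 => a b; exact: taboo_ge0.
Qed.

Lemma survival_le1 y n x : survival P y n x <= 1.
Proof.
elim: n x => [|n IH] x; first by rewrite survival0.
rewrite survivalS -(P1 x); apply: le_esum => z _.
rewrite /taboo; case: ifP => _; first by rewrite mul0e lee_fin.
by rewrite -[leRHS]mule1 lee_wpmul2l ?lee_fin.
Qed.

Lemma survival_fin y n x : survival P y n x \is a fin_num.
Proof.
by rewrite ge0_fin_numE ?survival_ge0// (le_lt_trans (survival_le1 _ _ _))// ltry.
Qed.

Lemma truncated_meanE y N x :
  (truncated_mean P y N x)%:E = \sum_(n < N) survival P y n x.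
Proof.
by rewrite fineK//; apply/sum_fin_numP => i _ _; exact: survival_fin.
Qed.

Lemma truncated_mean_ge0 y N x : (0 <= truncated_mean P y N x)%R.
Proof. by rewrite fine_ge0// sume_ge0// => *; exact: survival_ge0. Qed.
#[local] Hint Resolve truncated_mean_ge0 : core.

Lemma truncated_mean0 y x : truncated_mean P y 0 x = 0%R.
Proof. by rewrite /truncated_mean big_ord0. Qed.

Lemma truncated_mean_le y N x :
  (truncated_mean P y N x <= truncated_mean P y N.+1 x <=
   truncated_mean P y N x + 1)%R.
Proof.
rewrite -!lee_fin EFinD !truncated_meanE big_ord_recr /=.
by rewrite leeDl ?survival_ge0//= leeD2l// survival_le1.
Qed.

Lemma truncated_mean_ge1 y N x : (1 <= truncated_mean P y N.+1 x)%R.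
Proof.
rewrite -lee_fin truncated_meanE big_ord_recl /= survival0 leeDl// sume_ge0//.
by move=> *; exact: survival_ge0.
Qed.

(** A visit at time 0 counts here, whereas T_y in [truncated_mean] is at least
    1; the two times agree off the target. *)
Definition entrance_mean y N z : R :=
  if z == y then 0%R else truncated_mean P y N z.

Lemma entrance_mean_ge0 y N z : (0 <= entrance_mean y N z)%R.
Proof. by rewrite /entrance_mean; case: ifP. Qed.
#[local] Hint Resolve entrance_mean_ge0 : core.

(** First-step analysis: a step costs 1, and entering y ends the wait. *)
Lemma truncated_meanS y N x : (truncated_mean P y N.+1 x)%:E =
  1 + \esum_(z in [set: S]) (P x z)%:E * (entrance_mean y N z)%:E.
Proof.
rewrite truncated_meanE big_ord_recl /= survival0; congr (_ + _).
under eq_bigr do rewrite /bump /= add1n survivalS.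
rewrite -esum_sum; last first.
  by move=> i j _ _; rewrite mule_ge0 ?lee_fin ?taboo_ge0 ?survival_ge0.
apply: eq_esum => z _; rewrite -ge0_sume_distrr; last first.
  by move=> *; exact: survival_ge0.
rewrite -truncated_meanE /entrance_mean /taboo.
by case: ifP => // _; rewrite mul0e mule0.
Qed.

Lemma esumP (f : S -> R) x (c : R) : (forall z, (0 <= f z)%R) -> (0 <= c)%R ->
  \esum_(z in [set: S]) (P x z)%:E * (f z + c)%:E =
  \esum_(z in [set: S]) (P x z)%:E * (f z)%:E + c%:E.
Proof.
move=> f0 c0; under eq_esum do rewrite EFinD ge0_muleDr ?lee_fin//.
rewrite esumD; [|by move=> *; rewrite mule_ge0 ?lee_fin..].
congr (_ + _); rewrite -[RHS]mule1 -(P1 x) -ge0_esumZl//; last first.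
  by move=> *; rewrite lee_fin.
by apply: eq_esum => *; rewrite muleC.
Qed.

(** To reach y it is enough to go to e first and then from e to y. *)
Lemma truncated_mean_triangle e y N x :
  (truncated_mean P y N x <= truncated_mean P e N x + truncated_mean P y N e)%R.
Proof.
elim: N x => [|N IH] x; first by rewrite !truncated_mean0 addr0.
have /andP[le _] := truncated_mean_le y N e.
apply: le_trans (lerD (lexx _) le).
rewrite -lee_fin EFinD !truncated_meanS -addeA leeD2l// -esumP//.
apply: le_esum => z _; rewrite lee_wpmul2l ?lee_fin// /entrance_mean.
case: eqP => _; first by case: ifP => _; rewrite ?add0r ?addr_ge0.
by case: eqP => [->|_]; rewrite ?add0r ?IH.
Qed.

(** Take one step from x.  From z nothing is estimated; from any other state the
    walk is sent to e first, which costs M = m_y^N(e).  The saving P(x, z) M is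
    written on the left in order to avoid a subtraction. *)
Lemma entrance_mean_step e y N x z :
  (entrance_mean y N.+1 x + P x z * truncated_mean P y N e <=
   truncated_mean P e N.+1 x + P x z * entrance_mean y N z +
   truncated_mean P y N e)%R.
Proof.
set M := truncated_mean P y N e.
have M0 : (0 <= M)%R by exact: truncated_mean_ge0.
have le_entrance w : (entrance_mean y N w <= entrance_mean e N w + M)%R.
  rewrite /entrance_mean; case: eqP => _.
    by case: ifP => _; rewrite ?add0r ?addr_ge0.
  by case: eqP => [->|_]; rewrite ?add0r ?truncated_mean_triangle.
have : (entrance_mean y N.+1 x <= truncated_mean P y N.+1 x)%R.
  by rewrite {1}/entrance_mean; case: ifP.
rewrite -(lerD2r (P x z * M)%R) => /le_trans; apply.
rewrite -lee_fin !EFinD !truncated_meanS -!addeA leeD2l// [leRHS]addeCA.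
rewrite -(esumP _ _ M0)// (@esumD1 _ _ _ z)/=; last first.
  by move=> *; rewrite mule_ge0 ?lee_fin.
rewrite [in leRHS](@esumD1 _ _ _ z)/=; last first.
  by move=> *; rewrite mule_ge0 ?lee_fin ?addr_ge0.
rewrite -addeA EFinM leeD2l// addeC leeD//.
  by rewrite -EFinM lee_fin ler_wpM2l// lerDr.
by apply: le_esum => w _; case: ifP => // _; rewrite lee_wpmul2l ?lee_fin.
Qed.

(** The bound p m_e^N(z) <= m_e^(N+1)(x), with p = P(x, z), carries a multiple of
    m_e^N(e) along an edge; replacing N + 1 by N costs at
    most 1, and 1 <= m_e^N(e) for N > 0. *)
Lemma comparable_step e x z : (0 < P x z)%R -> z != e ->
  (exists C, forall N, (truncated_mean P e N x <= C * truncated_mean P e N e)%R) ->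
  exists C, forall N, (truncated_mean P e N z <= C * truncated_mean P e N e)%R.
Proof.
move=> p0 ze [C HC]; exists ((P x z)^-1 * (C + 1))%R => -[|N].
  by rewrite !truncated_mean0 mulr0.
rewrite -mulrA ler_pdivlMl// mulrDl mul1r.
apply: (@le_trans _ _ (truncated_mean P e N.+2 x)); last first.
  have /andP[_ /le_trans] := truncated_mean_le e N.+1 x; apply.
  by rewrite lerD ?truncated_mean_ge1.
rewrite -lee_fin [leRHS]truncated_meanS (@esumD1 _ _ _ z); last first.
  by move=> *; rewrite mule_ge0 ?lee_fin.
rewrite /entrance_mean (negPf ze) addeCA EFinM leeDl// adde_ge0 ?lee_fin//.
by apply: esum_ge0 => w _; case: ifP => // _; rewrite mule_ge0 ?lee_fin//; case: ifP.
Qed.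

(** Uniformly in N, the mean is at most C m_e^N(e) + (1 - a) m_y^N(e).  At x = e,
    for y other than e, this can be solved for m_y^N(e) because a > 0; here a
    bounds from below the chance of meeting y without falling back to e. *)
Definition excursion_bound e y x := exists a C, [/\ (0 < a)%R, (0 <= C)%R &
  forall N, (entrance_mean y N x + a * truncated_mean P y N e <=
    C * truncated_mean P e N e + truncated_mean P y N e)%R].

Lemma excursion_bound_target e y : excursion_bound e y y.
Proof.
exists 1%R, 0%R; split => // N.
by rewrite /entrance_mean eqxx mul1r mul0r.
Qed.

(** Along an edge of probability p, the success probability a becomes p a. *)
Lemma excursion_bound_step e y x z : (0 < P x z)%R ->
  (exists C, forall N, (truncated_mean P e N x <= C * truncated_mean P e N e)%R) ->
  excursion_bound e y z -> excursion_bound e y x.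
Proof.
set p := P x z => p0 [B HB] [a [C [a0 C0 HC]]].
exists (p * a)%R, (Num.max B 0 + p * C + p * a)%R; split.
- by rewrite mulr_gt0.
- have B0 : (0 <= Num.max B 0)%R by rewrite le_max lexx orbT.
  by rewrite !addr_ge0// mulr_ge0// ltW.
case=> [|N].
  by rewrite /entrance_mean !truncated_mean0 !mulr0 if_same !addr0.
have step := entrance_mean_step e y N x z; rewrite -/p in step.
have := truncated_mean_le y N e; have := truncated_mean_le e N e.
have := truncated_mean_ge1 e N e; have := HB N.+1; have := HC N.
move: step; set ux := entrance_mean y N.+1 x; set t := entrance_mean y N z.
set M := truncated_mean P y N e; set M' := truncated_mean P y N.+1 e.
set m := truncated_mean P e N e; set m' := truncated_mean P e N.+1 e.
set mx := truncated_mean P e N.+1 x => step HN HBN m1 /andP[mm _] /andP[MM M1].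
have h1 : (p * (t + a * M) <= p * (C * m + M))%R by rewrite ler_pM2l.
have h2 : (B * m' <= Num.max B 0 * m')%R.
  by rewrite ler_pM2r ?le_max ?lexx// (lt_le_trans ltr01).
(* m_y^(N+1)(e) exceeds m_y^N(e) by at most 1 <= m' *)
have h3 : (p * a * M' <= p * a * (M + m'))%R.
  by rewrite ler_pM2l ?mulr_gt0//; lra.
have h4 : (p * (C * m) <= p * (C * m'))%R by rewrite ler_pM2l// ler_wpM2l.
move: (Num.max B 0)%R h2 => B' h2.
by lra.
Qed.

(** Both recurrence and positive recurrence of y are read off this bound, whose
    constant does not depend on N. *)
Lemma truncated_mean_return e y :
  (exists C, forall N,
     (truncated_mean P e N y <= C * truncated_mean P e N e)%R) ->
  excursion_bound e y e ->
  exists C, (0 <= C)%R /\ forall N,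
    (truncated_mean P y N y <= C * truncated_mean P e N e)%R.
Proof.
move=> [B HB] [a [C [a0 C0 HC]]].
have [->|ye] := eqVneq y e.
  by exists 1%R; split => // N; rewrite mul1r.
exists (Num.max (B + a^-1 * C) 0)%R; split; first by rewrite le_max lexx orbT.
move=> N; apply: le_trans (truncated_mean_triangle e y N y) _.
apply: (@le_trans _ _ ((B + a^-1 * C) * truncated_mean P e N e)%R); last first.
  by rewrite ler_wpM2r// le_max lexx.
rewrite mulrDl lerD// -mulrA ler_pdivlMl//.
by have := HC N; rewrite /entrance_mean eq_sym (negPf ye) addrC lerD2r.
Qed.

Lemma survival_le y n x : survival P y n.+1 x <= survival P y n x.
Proof.
elim: n x => [|n IH] x; first by rewrite survival0 survival_le1.
rewrite survivalS [leRHS]survivalS; apply: le_esum => z _.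
by rewrite lee_wpmul2l// lee_fin taboo_ge0.
Qed.

Lemma survival_antitone y x m n : (m <= n)%N -> survival P y n x <= survival P y m x.
Proof.
move=> /subnK <-; elim: (n - m)%N => // k IH.
exact: le_trans (survival_le _ _ _) IH.
Qed.

(** The tails decrease, so N P_y(T_y > N - 1) <= m_y^N(y) <= C m_e^N(e), and
    m_e^N(e) / N is a Cesaro mean of the tails of T_e. *)
Lemma survival_cvg0 e y C : (0 <= C)%R ->
  (forall N, (truncated_mean P y N y <= C * truncated_mean P e N e)%R) ->
  survival P e n e @[n --> \oo] --> (0 : \bar R) ->
  survival P y n y @[n --> \oo] --> (0 : \bar R).
Proof.
move=> C0 HC /fine_cvgP[_ He]; apply/fine_cvgP; split.
  by near=> n; exact: survival_fin.
have avg z N : truncated_mean P z N z = series (fun n => fine (survival P z n z)) N.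
  apply: EFin_inj; rewrite truncated_meanE /series /= big_mkord -sumEFin.
  by apply: eq_bigr => i _; rewrite fineK// survival_fin.
have := cvgMl_tmp (a := C) (cesaro He).
rewrite mulr0 => Hm.
apply: (squeeze_cvgr _ (cvg_cst 0%R) (Hm _)).
near=> n; rewrite /= fine_ge0 ?survival_ge0//=.
rewrite /arithmetic_mean /= mulrCA ler_pdivlMl ?ltr0n// -avg.
apply: le_trans (HC n.+1); rewrite avg /series /= big_mkord mulr_natl.
rewrite -[X in (_ *+ X)%R]card_ord -sumr_const; apply: ler_sum => i _.
by rewrite fine_le ?survival_fin ?survival_antitone// -ltnS.
Unshelve. all: by end_near. Qed.

End transition.

(** * The covering graph *)

Section covering.
Context {disp : Order.disp_t} {S : bPOrderType disp}.
Implicit Types (x y z : S).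
Local Open Scope order_scope.

Lemma covers_lt x z : covers x z -> x < z.
Proof. by case. Qed.

Lemma covers_neq_bot x z : covers x z -> z != \bot.
Proof. by move=> /covers_lt xz; apply: contraTneq xz => ->; rewrite ltx0. Qed.

Lemma finite_total_max (T : choiceType) (r : rel T) (A : set T) (a : T) :
  transitive r -> finite_set A -> total_on A (fun u v : T => r u v) -> A a ->
  exists2 m, A m & forall t, A t -> r t m.
Proof.
move=> rtr /finite_seqP[s As] totA Aa.
have sA : {subset s <= A} by move=> t; rewrite As inE.
have {}As t : A t -> t \in s by rewrite As.
have [m ms mM] : exists2 m, m \in s & forall t, t \in s -> r t m.
  have {As Aa} := As _ Aa; elim: s a sA => // b s IH a sA _.
  have [->|[c cs]] : s = [::] \/ exists c, c \in s.
    by case: (s) => [|c s']; [left|right; exists c; exact: mem_head].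
    exists b; first exact: mem_head.
    move=> t; rewrite inE => /eqP ->.
    by have Ab := set_mem (sA _ (mem_head b _)); have [] := totA b b Ab Ab.
  have [|m ms mM] := IH c _ cs.
    by move=> t ts; apply: sA; rewrite inE ts orbT.
  have Ab := set_mem (sA _ (mem_head b s)).
  have Am : A m by apply: set_mem; apply: sA; rewrite inE ms orbT.
  have [bm|mb] := totA b m Ab Am.
    exists m; first by rewrite inE ms orbT.
    by move=> t; rewrite inE => /orP[/eqP -> //|/mM].
  exists b; first exact: mem_head.
  move=> t; rewrite inE => /orP[/eqP ->|/mM tm]; last exact: rtr tm mb.
  by have [] := totA b b Ab Ab.
by exists m => [|t /As]; [exact/set_mem/sA|exact: mM].
Qed.

(** Induction along covers reaches every x: a maximal chain below x is finite, and
    by maximality the least element in it that violates Q covers its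
    predecessor in it. *)
Lemma cover_ind (S_chains : finite_chains S) (Q : S -> Prop) :
  Q \bot -> (forall x z, covers x z -> Q x -> Q z) -> forall x, Q x.
Proof.
move=> Q0 QS x.
pose chain (C : set S) := total_on C (fun a b : S => a <= b) /\
   (forall y, C y -> y <= x).
have [|C [[totC Cx] maxC]] := @Zorn_bigcup S chain.
  move=> F Fchain totF; split; last by move=> y [A /Fchain[_ h]]; exact: h.
  move=> a b [A FA Aa] [B FB Bb].
  have [AB|BA] := totF _ _ FA FB.
    by have [totB _] := Fchain _ FB; apply: totB => //; exact: AB.
  by have [totA _] := Fchain _ FA; apply: totA => //; exact: BA.
(* maximality: the chain contains every t <= x comparable to its elements *)
have add t : t <= x -> (forall c, C c -> t <= c \/ c <= t) -> C t.
  move=> tx tC; apply: contrapT => Ct.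
  apply: (maxC (C `|` [set t])).
    split; first by move=> c; left.
    by move=> /(_ t (or_intror erefl)).
  split; last by move=> y [/Cx//|->].
  move=> a b [Ca|->] [Cb|->].
  - exact: totC.
  - by have [|] := tC a Ca; [right|left].
  - by have [|] := tC b Cb; [left|right].
  - by left.
have C0 : C \bot by apply: add => [|c _]; [|left]; exact: le0x.
have Cxx : C x by apply: add => // c /Cx; right.
have finC : finite_set C.
  by apply: (S_chains x C totC C0 Cxx) => y Cy; rewrite le0x Cx.
apply: contrapT => nQx.
have sub (B : set S) :
    B `<=` C -> finite_set B /\ total_on B (fun a b : S => a <= b).
  move=> BC; split; first exact: sub_finite_set finC.
  by move=> a b /BC Ca /BC Cb; exact: totC.
have [finB totB] := sub (C `&` [set t | ~ Q t])%classic (@subIsetl _ _ _).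
have [||m [Cm nQm] mmin] :=
    @finite_total_max S (fun a b => b <= a) _ x _ finB _ (conj Cxx nQx).
- by move=> a b c /= ba ac; exact: le_trans ac ba.
- by move=> a b Ba Bb; have [] := totB a b Ba Bb; [right|left].
have m0 : \bot < m by rewrite lt0x; apply/eqP => m0; apply: nQm; rewrite m0.
have [finD totD] := sub (C `&` [set t | t < m])%classic (@subIsetl _ _ _).
have [|b [Cb bm] bmax] :=
    @finite_total_max S (fun a b => a <= b) _ \bot _ finD totD (conj C0 m0).
  exact: le_trans.
apply: nQm; apply: (QS b).
  split=> // t bt tm.
  have Ct : C t.
    apply: add => [|c Cc]; first exact: le_trans (ltW tm) (Cx _ Cm).
    have [mc|cm] := totC m c Cm Cc; first by left; exact: le_trans (ltW tm) mc.
    have [->|cNm] := eqVneq c m; first by left; exact: ltW.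
    right; apply: le_trans (ltW bt); apply: bmax; split => //=.
    by rewrite lt_neqAle cNm.
  by have := lt_le_trans bt (bmax t (conj Ct tm)); rewrite ltxx.
apply: contrapT => nQb.
by have := lt_le_trans bm (mmin b (conj Cb nQb)); rewrite ltxx.
Qed.

Hypotheses (S_chains : finite_chains S) (S_uniform : uniform S).

Lemma cover_path_bot x : exists p : seq S, cover_path \bot p x.
Proof.
elim/(cover_ind S_chains): x => [|x z xz [p [px lx]]]; first by exists [::].
exists (rcons p z); split; last by rewrite last_rcons.
by rewrite rcons_path px lx; exact/asboolP.
Qed.

Lemma dist_botE x p : cover_path \bot p x -> dist_bot x = size p.
Proof.
move=> px; rewrite /dist_bot; case: xgetP => [n -> [q [qx <-]]|].
  exact: S_uniform qx px.
by move=> /(_ (size p)) []; exists p.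
Qed.

Lemma dist_bot0 : dist_bot (\bot : S) = 0%N.
Proof. by apply: (@dist_botE \bot [::]). Qed.

Lemma dist_bot_cover x z : covers x z -> dist_bot z = (dist_bot x).+1.
Proof.
move=> xz; have [p [px lx]] := cover_path_bot x.
rewrite (@dist_botE x p)// (@dist_botE z (rcons p z)) ?size_rcons//.
split; last by rewrite last_rcons.
by rewrite rcons_path px lx; exact/asboolP.
Qed.

Lemma dist_bot_eq0 x : (dist_bot x = 0)%N -> x = \bot.
Proof.
have [p px] := cover_path_bot x; rewrite (dist_botE px) => /size0nil p0.
by case: px; rewrite p0.
Qed.

End covering.

(** * Laws of hitting times *)

Section chain_measure.
Context {R : realType} {S : choiceType} {d : measure_display}
  {Omega : measurableType d}.
Variables (P : S -> S -> R) (X : nat -> Omega -> S)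
  (Pr : S -> probability Omega R).
Hypotheses (S_countable : countable [set: S]) (Ptr : transition_function P)
  (X_chain : markov_chain P X Pr).

Let P0 x y : (0 <= P x y)%R. Proof. by case: Ptr. Qed.
#[local] Hint Resolve P0 : core.

Lemma measurable_state n (A : set S) : measurable (X n @^-1` A).
Proof.
have -> : X n @^-1` A =
    \bigcup_x (if x \in A then X n @^-1` [set x] else set0).
  apply/seteqP; split=> [w Aw|w [x _]]; first by exists (X n w); rewrite ?mem_set.
  by case: ifPn => // /set_mem Ax /= ->.
apply: countable_bigcupT_measurable => // x.
by case: ifP => // _; exact: chain_measurable X_chain n x.
Qed.

Lemma measurable_history n (A : nat -> set S) :
  measurable [set w | forall i, (i <= n)%N -> A i (X i w)].
Proof.
have -> : [set w | forall i, (i <= n)%N -> A i (X i w)] =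
    \bigcap_(i in [set i | (i <= n)%N]) (X i @^-1` A i).
  by apply/seteqP; split=> w h i; exact: h.
by apply: bigcap_measurable => [|i _]; [exists 0%N|exact: measurable_state].
Qed.

(** An enumeration of the countable state space turns the partition by the value
    of X_n into a sequence. *)
Lemma measure_state_partition (mu : {measure set Omega -> \bar R}) n B :
  measurable B ->
  mu B = \esum_(z in [set: S]) mu (B `&` X n @^-1` [set z]).
Proof.
move=> mB; have /countable_injP[f finj] := S_countable.
pose G k := B `&` X n @^-1` (f @^-1` [set k]).
have mG k : measurable (G k) by apply: measurableI => //; exact: measurable_state.
have {1}-> : B = \bigcup_k G k.
  by apply/seteqP; split=> [w Bw|w [k _ []]//]; exists (f (X n w)).
rewrite measure_bigcup//; last first.
  apply/trivIsetP => i j _ _ /eqP ij; rewrite -subset0 => w [[_ /= fi] [_ /= fj]].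
  by apply: ij; rewrite -fi -fj.
rewrite nneseries_esum ?set_mem_set; last by move=> k _; exact: measure_ge0.
transitivity (\esum_(k in f @` [set: S]) mu (G k)).
  rewrite [LHS]esum_mkcond [RHS]esum_mkcond; apply: eq_esum => k _.
  rewrite mem_set//; case: ifPn => // /negP kf.
  suff -> : G k = set0 by rewrite measure0.
  rewrite -subset0 => w [_ /= fk]; apply: kf; apply: mem_set.
  by exists (X n w).
rewrite esum_image; last first.
  by move=> x y _ _; apply: finj; rewrite inE.
apply: eq_esum => z _; congr (mu _); apply/seteqP; split=> w [Bw /=].
  by move=> /finj ->//; rewrite inE.
by move=> <-.
Qed.

(** The Markov property for histories confined to sets.  Only the coordinates
    from m on are pinned to s; summing over the value of the coordinate m
    passes from m to m + 1. *)
Lemma markov_history x n m (A : nat -> set S) (s : nat -> S) y : (m <= n)%N ->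
  let E := [set w | forall i, (i <= n)%N ->
    A i (X i w) /\ ((m <= i)%N -> X i w = s i)] in
  Pr x (E `&` X n.+1 @^-1` [set y]) = Pr x E * (P (s n) y)%:E.
Proof.
elim: m s => [|m IH] s mn E.
  have [As|nAs] := pselect (forall i, (i <= n)%N -> A i (s i)).
    have -> : E = [set w | forall i, (i <= n)%N -> X i w = s i].
      apply/seteqP; split=> w Ew i /[dup] lin /Ew; first by move=> [_]; exact.
      by move=> ->; split => //; exact: As.
    exact: (chain_markov X_chain).
  have -> : E = set0.
    rewrite -subset0 => w Ew; apply: nAs => i lin.
    by have [Ai /(_ isT) <-] := Ew i lin.
  by rewrite set0I measure0 mul0e.
have mE : measurable E.
  exact: (measurable_history n
    (fun i => A i `&` [set z | (m.+1 <= i)%N -> z = s i])).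
(* the history s with its m-th value replaced by z *)
pose s' (z : S) (i : nat) := if i == m then z else s i.
have Ez z : E `&` X m @^-1` [set z] =
    [set w | forall i, (i <= n)%N -> A i (X i w) /\ ((m <= i)%N -> X i w = s' z i)].
  apply/seteqP; split=> w /=.
    move=> [Ew Xz] i lin; have [Ai si] := Ew i lin; split => // mi.
    rewrite /s'; case: eqP => [->//|/eqP im]; apply: si.
    by rewrite ltn_neqAle eq_sym im.
  move=> Ew; split; last by have [_ ->] := Ew m (ltnW mn); rewrite // /s' eqxx.
  move=> i lin; have [Ai si] := Ew i lin; split => // mi.
  by rewrite si 1?ltnW// /s' gtn_eqF.
rewrite (@measure_state_partition (Pr x) m); last first.
  by apply: measurableI => //; exact: measurable_state.
rewrite [in RHS](@measure_state_partition (Pr x) m)// muleC -ge0_esumZl//.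
apply: eq_esum => z _; rewrite setIAC Ez.
by apply: etrans (IH (s' z) (ltnW mn)) _; rewrite [LHS]muleC /s' gtn_eqF.
Qed.

Lemma chain_start_neq x z : Pr x (X 0%N @^-1` [set z]) = (x == z)%:R%:E.
Proof.
have [->|xz] := eqVneq x z; first exact: (chain_start X_chain).
have mz := measurable_state 0 [set z]; have mx := measurable_state 0 [set x].
have h0 : Pr x (~` (X 0%N @^-1` [set x])) = 0.
  by rewrite probability_setC// (chain_start X_chain) subee.
apply/eqP; rewrite eq_le measure_ge0 andbT -[leRHS]/0 -h0.
apply: le_measure; rewrite ?inE//; first exact: measurableC.
by move=> w /= -> /eqP; rewrite eq_sym (negPf xz).
Qed.

Definition avoid (y : S) (n : nat) : set Omega :=
  [set w | forall i, (i <= n)%N -> (0 < i)%N -> X i w != y].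

Lemma measurable_avoid y n : measurable (avoid y n).
Proof.
by have := measurable_history n (fun i => [set z | (0 < i)%N -> z != y]).
Qed.

(** Killing the kernel at y amounts to avoiding y at the times 1, ..., n. *)
Lemma avoid_taboo x y n z :
  Pr x (avoid y n `&` X n @^-1` [set z]) = nstep (taboo P y) n x z.
Proof.
elim: n z => [|n IH] z.
  rewrite /= -chain_start_neq; congr (Pr x _); apply/seteqP.
  by split=> [w []//|w h]; split => // i; case: i.
rewrite nstepSr; last by move=> a b; exact: taboo_ge0.
have [->|zy] := eqVneq z y.
  rewrite esum1; last by move=> w _; rewrite /taboo eqxx mule0.
  suff -> : avoid y n.+1 `&` X n.+1 @^-1` [set y] = set0 by rewrite measure0.
  rewrite -subset0 => w [/(_ n.+1 (leqnn _) isT) /eqP]; exact.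
rewrite (@measure_state_partition (Pr x) n); last first.
  by apply: measurableI; [exact: measurable_avoid|exact: measurable_state].
apply: eq_esum => u _; rewrite -IH /taboo (negPf zy).
have := @markov_history x n n
  (fun i => [set z | (0 < i)%N -> z != y]) (fun=> u) z (leqnn n).
have -> : [set w | forall i, (i <= n)%N -> ([set z | (0 < i)%N -> z != y] (X i w)) /\
    ((n <= i)%N -> X i w = u)] = avoid y n `&` X n @^-1` [set u].
  apply/seteqP; split=> w /=.
    by move=> h; split=> [i /h[]//|]; have [_ ->] := h n (leqnn n).
  move=> [h hu] i lin; split; first exact: h.
  by move=> ni; rewrite -hu; congr X; apply/eqP; rewrite eqn_leq lin.
move=> <-; congr (Pr x _); apply/seteqP; split=> w /=.
  by move=> [[h hz] hu]; split => //; split => // i lin; apply: h; exact: leqW.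
move=> [[h hu] hz]; split => //; split => // i; rewrite leq_eqVlt => /orP[/eqP ->|].
  by rewrite hz.
exact: h.
Qed.

Lemma avoid_survival x y n : Pr x (avoid y n) = survival P y n x.
Proof.
rewrite (@measure_state_partition (Pr x) n)//; last exact: measurable_avoid.
by apply: eq_esum => z _; exact: avoid_taboo.
Qed.

Lemma hitting_time_gtE y n :
  [set w | n%:R%:E < hitting_time X y w :> \bar R] = avoid y n.
Proof.
apply/seteqP; split=> [w /= nT i lin i0|w h /=].
  apply/eqP => Xi; move: nT; apply/negP; rewrite -leNgt.
  by apply: ge_ereal_inf; exists i%:R%:E; [exists i|rewrite lee_fin ler_nat].
apply: (@lt_le_trans _ _ n.+1%:R%:E); first by rewrite lte_fin ltr_nat.
apply: le_ereal_inf_tmp => _ [i [i1 Xi] <-]; rewrite lee_fin ler_nat ltnNge.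
by apply/negP => lin; have := h i lin i1; rewrite Xi eqxx.
Qed.

Lemma hitting_time_finE y :
  [set w | hitting_time X y w < +oo :> \bar R] = ~` \bigcap_n avoid y n.
Proof.
apply/seteqP; split=> w /=.
  move=> /ereal_inf_lt[_ [i [i1 Xi] _] _] /(_ i I i (leqnn i) i1).
  by rewrite Xi eqxx.
apply: contra_notP => /negP; rewrite -leNgt leye_eq => /eqP Ty n _.
by rewrite -hitting_time_gtE /= Ty ltry.
Qed.

(** The events {T_y > n} decrease to {T_y = oo}. *)
Lemma return_survival x y :
  Pr x [set w | hitting_time X y w < +oo :> \bar R] = 1 <->
  survival P y n x @[n --> \oo] --> (0 : \bar R).
Proof.
have mcap : measurable (\bigcap_n avoid y n).
  by apply: bigcap_measurable => [|n _]; [exists 0%N|exact: measurable_avoid].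
rewrite hitting_time_finE probability_setC//.
have cvgs : survival P y n x @[n --> \oo] --> Pr x (\bigcap_n avoid y n).
  under eq_fun do rewrite -avoid_survival.
  apply: nonincreasing_cvg_mu => //.
  - by rewrite (le_lt_trans (probability_le1 _ _)) ?ltry//; exact: measurable_avoid.
  - by move=> n; exact: measurable_avoid.
  - by move=> m n mn; apply/subsetPset => w h i lim; apply: h; exact: leq_trans mn.
split=> [h|h].
  suff -> : (0 : \bar R) = Pr x (\bigcap_n avoid y n) by [].
  move: h (fin_num_measure (Pr x) _ mcap); case: (Pr x _) => // r.
  by rewrite -EFinB => -[] /eqP; rewrite subr_eq addrC -subr_eq subrr => /eqP <-.
by rewrite (cvg_unique _ cvgs h) ?sube0.
Qed.

(** A random time with values in {1, 2, ..., oo} is the sum over n of the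
    indicators of {T_y > n}. *)
Lemma hitting_time_series y w :
  hitting_time X y w = \sum_(0 <= n <oo) (\1_(avoid y n) w)%:E :> \bar R.
Proof.
have [[i [i1 Xi]]|noX] := pselect (exists i, (0 < i)%N /\ X i w = y).
  have exk : exists i, (0 < i)%N && (X i w == y) by exists i; rewrite i1 Xi eqxx.
  case: (ex_minnP exk) => k /andP[k0 /eqP Xk] kmin {i i1 Xi exk}.
  have av n : (n < k)%N <-> avoid y n w.
    split=> [nk i lin i0|h].
      apply/eqP => Xi; have := kmin i; rewrite i0 Xi eqxx => /(_ isT).
      by rewrite leqNgt (leq_ltn_trans lin).
    by rewrite ltnNge; apply/negP => kn; have := h k kn k0; rewrite Xk eqxx.
  have -> : hitting_time X y w = k%:R%:E :> \bar R.
    apply/eqP; rewrite eq_le; apply/andP; split.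
      by apply: ereal_inf_lbound; exists k.
    apply: le_ereal_inf_tmp => _ [i [i1 Xi] <-]; rewrite lee_fin ler_nat.
    by apply: kmin; rewrite i1 Xi eqxx.
  apply/esym/lim_near_cst => //; near=> N.
  rewrite (big_cat_nat (n := k))//=; last by near: N; exists k.
  rewrite [X in _ + X]big1_seq ?adde0; last first.
    move=> n /andP[_]; rewrite mem_index_iota indicE => /andP[kn _].
    by rewrite memNset// => /av; rewrite ltnNge kn.
  rewrite (eq_big_nat _ _ (F2 := fun=> 1)); last first.
    by move=> n /andP[_ /av nk]; rewrite indicE mem_set.
  by rewrite big_mkord sumEFin sumr_const card_ord.
have av n : avoid y n w.
  by move=> i _ i0; apply/eqP => Xi; apply: noX; exists i.
have -> : hitting_time X y w = +oo :> \bar R.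
  by apply/ereal_inf_pinfty => _ [i [i1 Xi] <-]; case: noX; exists i.
apply/esym/eqyP => A A0.
apply: le_trans (nneseries_lim_ge (Num.truncn A).+1 _) => //.
rewrite (eq_bigr (fun=> 1)); last by move=> n _; rewrite indicE mem_set.
rewrite big_mkord sumEFin sumr_const card_ord lee_fin ltW//.
  exact: truncnS_gt.
Unshelve. all: by end_near. Qed.

Lemma mean_return_series y :
  mean_return X Pr y = \sum_(0 <= n <oo) survival P y n y.
Proof.
rewrite /mean_return; under eq_integral do rewrite hitting_time_series.
rewrite integral_nneseries//; last first.
  move=> n; apply/measurable_EFinP; apply: measurable_indic.
  exact: measurable_avoid.
apply: eq_eseriesr => n _.
rewrite integral_indic// ?setIT; last exact: measurable_avoid.
exact: avoid_survival.
Qed.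

(** If T_x < T_e, then x is visited at the positive time T_x,
    before which, and at which, e is not visited. *)
Lemma hit_before_bigcup x e : x != e ->
  [set w | hitting_time X x w < hitting_time X e w :> \bar R] =
  \bigcup_n (avoid e n.+1 `&` X n.+1 @^-1` [set x]).
Proof.
move=> xe; apply/seteqP; split=> w /=.
  move=> /ereal_inf_lt[_ [i [i1 Xi] <-]]; case: i i1 Xi => [//|n] _ Xn.
  by move=> lt_e; exists n => //; split; first by rewrite -hitting_time_gtE.
move=> [n _ [+ /= Xn]]; rewrite -hitting_time_gtE /=; apply: le_lt_trans.
by apply: ereal_inf_lbound; exists n.+1.
Qed.

End chain_measure.

(** * Upward run chains *)

Section upward.
Context {R : realType} {disp : Order.disp_t} {S : bPOrderType disp}.
Variable P : S -> S -> R.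
Hypotheses (S_chains : finite_chains S) (S_uniform : uniform S)
  (P_up : upward_run P).
Implicit Types (x y z : S).
Local Notation e := (\bot%O : S).

Let Ptr : transition_function P. Proof. by case: P_up. Qed.
Let P0 x y : (0 <= P x y)%R. Proof. by case: Ptr. Qed.
Let P1 x : \esum_(y in [set: S]) (P x y)%:E = 1. Proof. by case: Ptr. Qed.
#[local] Hint Resolve P0 : core.
Let K0 n x : 0 <= nstep P n e x. Proof. exact: nstep_ge0. Qed.
#[local] Hint Resolve K0 : core.

Lemma upward_cover_gt0 x z : covers x z -> (0 < P x z)%R.
Proof. by move=> xz; have [_ Pp] := P_up; rewrite Pp; left. Qed.

Lemma upward_level x z : z != e -> dist_bot z != (dist_bot x).+1 -> P x z = 0%R.
Proof.
move=> ze zx; apply/eqP; rewrite eq_le P0 andbT leNgt; apply/negP.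
have [_ Pp] := P_up; rewrite Pp => -[xz|/eqP]; last by rewrite (negPf ze).
by move: zx; rewrite (dist_bot_cover S_chains S_uniform xz) eqxx.
Qed.

Lemma nstep_level n x : x != e -> dist_bot x = n.+1 ->
  nstep P n.+1 e x =
  \esum_(z in [set: S]) (if dist_bot z == n then nstep P n e z else 0) * (P z x)%:E.
Proof.
move=> xe xn; rewrite nstepSr//; apply: eq_esum => z _.
case: eqP => // /eqP zn; rewrite upward_level ?mule0//.
by rewrite xn eqSS eq_sym.
Qed.

(** The level at time n is n exactly on the event T_e > n: by induction, a state of
    level n + 1 is entered from level n only, and from level n the chain enters
    level n + 1 or e. *)
Lemma taboo_bot_level n x : nstep (taboo P e) n e x =
  if dist_bot x == n then nstep P n e x else 0.
Proof.
elim: n x => [|n IH] x.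
  have [/(dist_bot_eq0 S_chains S_uniform) ->//|x0] /= := eqVneq (dist_bot x) 0%N.
  by case: eqVneq => // ex; move: x0; rewrite -ex dist_bot0 ?eqxx.
rewrite nstepSr; last by move=> a b; exact: taboo_ge0.
have [->|xe] := eqVneq x e.
  rewrite (dist_bot0 S_uniform) esum1// => z _.
  by rewrite /taboo eqxx mule0.
have -> : \esum_(z in [set: S]) nstep (taboo P e) n e z * (taboo P e z x)%:E =
  \esum_(z in [set: S]) (if dist_bot z == n then nstep P n e z else 0) * (P z x)%:E.
  by apply: eq_esum => z _; rewrite IH /taboo (negPf xe).
case: eqP => [xn|/eqP xn]; first by rewrite nstep_level.
rewrite esum1// => z _; case: eqP => [zn|_]; last by rewrite mul0e.
by rewrite upward_level ?mule0 ?zn.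
Qed.

Lemma survival_level n : survival P e n e = nstep_set P n e (level n).
Proof.
rewrite /survival /nstep_set [RHS]esum_mkcond; apply: eq_esum => x _.
by rewrite taboo_bot_level; congr (if _ then _ else _); apply/eqP/idP; rewrite inE.
Qed.

(** Cover paths from e to y exist, and their edges have positive probability:
    [comparable_step] is used along such a path, [excursion_bound_step] backwards
    along it. *)
Lemma truncated_mean_return_bot y : exists C, (0 <= C)%R /\ forall N,
  (truncated_mean P y N y <= C * truncated_mean P e N e)%R.
Proof.
have cmp x : exists C, forall N,
    (truncated_mean P e N x <= C * truncated_mean P e N e)%R.
  elim/(cover_ind S_chains): x => [|x z xz].
    by exists 1%R => N; rewrite mul1r.
  apply: comparable_step => //.
  - exact: upward_cover_gt0.
  - exact: covers_neq_bot xz.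
apply: truncated_mean_return => //.
have : excursion_bound P e y y -> excursion_bound P e y e;
  last by apply; exact: excursion_bound_target.
elim/(cover_ind S_chains): {2}y => // x z xz IH dz; apply: IH.
by apply: excursion_bound_step (upward_cover_gt0 xz) _ dz.
Qed.

(** The function F, proportional to the invariant density; the only step count at
    which a state can be reached without a return to e is its level. *)
Definition hit_density x : \bar R := nstep P (dist_bot x) e x.

Lemma esum_hit_density : \esum_(x in [set: S]) hit_density x =
  \sum_(0 <= n <oo) nstep_set P n e (level n).
Proof.
have -> : [set: S] = \bigcup_n level n.
  by apply/seteqP; split=> // x _; exists (dist_bot x).
rewrite nneseries_sum_bigcup//; last first.
- by move=> x; exact: K0.
- apply/trivIsetP => i j _ _ /eqP ij; rewrite -subset0 => x [/= xi xj].
  by apply: ij; rewrite -xi.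
by apply: eq_eseriesr => n _; apply: eq_esum => x; rewrite /hit_density => ->.
Qed.

Lemma hit_density_flow y : y != e ->
  \esum_(z in [set: S]) hit_density z * (P z y)%:E = hit_density y.
Proof.
move=> ye; rewrite /hit_density.
have [n yn] : exists n, dist_bot y = n.+1.
  case E : (dist_bot y) => [|n]; last by exists n.
  by move: ye; rewrite (dist_bot_eq0 S_chains S_uniform E) eqxx.
rewrite yn nstep_level//; apply: eq_esum => z _.
case: eqP => [->//|/eqP zn]; rewrite upward_level ?mule0// yn eqSS eq_sym.
exact: zn.
Qed.

(** Balance at e is not checked directly: the total mass is preserved and balance
    holds at every other state. *)
Lemma invariant_pdf_density (m : R) (f : S -> R) :
  (0 < m)%R -> \esum_(x in [set: S]) hit_density x = m%:E ->
  (forall x, (f x)%:E = hit_density x * (m^-1)%:E) -> invariant_pdf P f.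
Proof.
move=> m0 sumF fF.
have F0 x : 0 <= hit_density x by exact: K0.
have im0 : (0 <= m^-1)%R by rewrite invr_ge0 ltW.
have f0 x : (0 <= f x)%R by rewrite -lee_fin fF mule_ge0.
have fF' x : (f x)%:E = (m^-1)%:E * hit_density x by rewrite fF muleC.
have sumf : \esum_(x in [set: S]) (f x)%:E = 1.
  under eq_esum do rewrite fF'.
  by rewrite ge0_esumZl// sumF -EFinM mulVf ?gt_eqF.
have fP0 x y : 0 <= (f x)%:E * (P x y)%:E by rewrite mule_ge0 ?lee_fin.
have flow y : y != e -> \esum_(x in [set: S]) (f x)%:E * (P x y)%:E = (f y)%:E.
  move=> ye; under eq_esum do rewrite fF' -muleA.
  rewrite ge0_esumZl ?hit_density_flow// => x.
  by rewrite mule_ge0 ?lee_fin.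
split=> // y; have [{y}->|] := eqVneq y e; last exact: flow.
have : \esum_(y in [set: S]) \esum_(x in [set: S]) (f x)%:E * (P x y)%:E = 1.
  rewrite esum_exchange// -sumf; apply: eq_esum => x _.
  rewrite ge0_esumZl// ?P1 ?mule1// => y.
  by rewrite lee_fin.
rewrite (@esumD1 _ _ (fun y => \esum_(x in [set: S]) (f x)%:E * (P x y)%:E) e);
  last by move=> y; exact: esum_ge0.
move: sumf; rewrite (@esumD1 _ _ (EFin \o f) e)/=; last by move=> y; rewrite lee_fin.
have -> : \esum_(y in [set: S]) (if y == e then 0 else
    \esum_(x in [set: S]) (f x)%:E * (P x y)%:E) =
    \esum_(y in [set: S]) (if y == e then 0 else (f y)%:E).
  by apply: eq_esum => y _; case: ifPn => // /flow.
set rest := \esum_(y in [set: S]) (if _ then _ else _) => e1.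
have restfin : rest \is a fin_num.
  rewrite ge0_fin_numE; last by apply: esum_ge0 => y _; case: ifP; rewrite ?lee_fin.
  by rewrite (@le_lt_trans _ _ 1) ?ltry// -e1 leeDr ?lee_fin.
rewrite -e1 => eq_sums; have := congr1 (fun u => u - rest) eq_sums.
by rewrite /= !addeK.
Qed.

(** Balance at level n + 1 expresses f in terms of its values at level n, hence
    f = f(e) F, and the total mass gives f(e). *)
Lemma invariant_pdf_unique (m : R) (f : S -> R) :
  (0 < m)%R -> \esum_(x in [set: S]) hit_density x = m%:E ->
  invariant_pdf P f -> forall x, (f x)%:E = hit_density x * (m^-1)%:E.
Proof.
move=> m0 sumF [f0 sumf inv].
have fF n x : dist_bot x = n -> (f x)%:E = (f e)%:E * nstep P n e x.
  elim: n x => [|n IH] x xn.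
    by rewrite (dist_bot_eq0 S_chains S_uniform xn) /= eqxx mule1.
  have xe : x != e by apply: contra_eq_neq xn => ->; rewrite dist_bot0.
  rewrite -inv nstep_level// -ge0_esumZl//; last first.
    by move=> z; rewrite mule_ge0 ?lee_fin//; case: ifP.
  apply: eq_esum => z _; case: eqP => [zn|/eqP zn]; first by rewrite IH ?muleA.
  by rewrite upward_level ?mul0e ?mule0// xn eqSS eq_sym.
have feE : f e = m^-1%R.
  have : \esum_(x in [set: S]) (f e)%:E * hit_density x = 1.
    by rewrite -sumf; apply: eq_esum => x _; rewrite (fF _ x erefl).
  rewrite ge0_esumZl// ?sumF; last by move=> x; exact: K0.
  rewrite -EFinM => -[] fm; apply: (mulIf (lt0r_neq0 m0)).
  by rewrite fm mulVf ?gt_eqF.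
by move=> x; rewrite (fF _ x erefl) feE muleC.
Qed.

End upward.

Theorem mainTheorem12 (R : realType)
  (disp : Order.disp_t) (S : bPOrderType disp)
  (S_countable : countable [set: S])
  (S_chains : finite_chains S)
  (S_uniform : uniform S)
  (P : S -> S -> R) (P_up : upward_run P)
  (d : measure_display) (Omega : measurableType d)
  (X : nat -> Omega -> S) (Pr : S -> probability Omega R)
  (X_chain : markov_chain P X Pr) :
  let e : S := \bot%O in
  let mu := mean_return X Pr e in
  (forall (n : nat) (x : S), level n x -> hit_prob X Pr x = nstep P n e x) /\
  ((forall n : nat,
      Pr e [set w | n%:R%:E < hitting_time X e w :> \bar R] =
      nstep_set P n e (level n)) /\
   (recurrent X Pr <->
    (fun n : nat => nstep_set P n e (level n)) @ \oo --> (0 : \bar R))) /\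
  (mu = \sum_(0 <= n <oo) nstep_set P n e (level n) /\
   (positive_recurrent X Pr <-> mu < +oo) /\
   (positive_recurrent X Pr ->
    forall f : S -> R,
      invariant_pdf P f <->
      (forall (n : nat) (x : S),
         level n x -> (f x)%:E = nstep P n e x / mu))).
Proof.
move=> e mu.
have [Ptr _] := P_up.
have [P0 P1] := Ptr.
have gtE n : Pr e [set w | n%:R%:E < hitting_time X e w :> \bar R] =
    nstep_set P n e (level n).
  rewrite hitting_time_gtE -survival_level//.
  exact: avoid_survival.
have muE : mu = \sum_(0 <= n <oo) nstep_set P n e (level n).
  rewrite /mu (mean_return_series S_countable Ptr X_chain).
  by apply: eq_eseriesr => n _; rewrite survival_level.
have mu_sum : mu = \sum_(0 <= n <oo) survival P e n e.
  by rewrite muE; apply: eq_eseriesr => n _; rewrite survival_level.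
split; [|split; [split=> //|split=> //; split]].
- move=> n x xn; rewrite /hit_prob; case: eqVneq => [x0|xe].
    by move: xn; rewrite x0 /level /= dist_bot0// => <-; rewrite /= eqxx.
  have [k xk] : exists k, dist_bot x = k.+1.
    case E : (dist_bot x) => [|k]; last by exists k.
    by move: xe; rewrite (dist_bot_eq0 S_chains S_uniform E) eqxx.
  rewrite hit_before_bigcup//.
  (* time j + 1 contributes only if it is the level of x *)
  pose G j := avoid X e j.+1 `&` X j.+1 @^-1` [set x].
  have mG j : measurable (G j).
    apply: measurableI; first exact: (measurable_avoid S_countable X_chain).
    exact: (measurable_state S_countable X_chain).
  have PG j : Pr e (G j) = if dist_bot x == j.+1 then nstep P j.+1 e x else 0.
    by rewrite -taboo_bot_level//; exact: avoid_taboo.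
  have nk : n = k.+1 by rewrite -xk -xn.
  have mU : measurable (\bigcup_j G j) by exact: bigcupT_measurable.
  apply/eqP; rewrite eq_le; apply/andP; split.
    have : Pr e (\bigcup_j G j) <= \sum_(0 <= j <oo) Pr e (G j).
      exact: generalized_Boole_inequality.
    rewrite nneseries_esumT//.
    rewrite (@esum_single _ _ _ k) ?measure_ge0//; first by rewrite PG xk eqxx nk.
    by move=> j jk; rewrite PG xk eqSS eq_sym (negPf jk).
  have -> : nstep P n e x = Pr e (G k) by rewrite PG xk eqxx nk.
  by apply: le_measure; rewrite ?inE//; exact: bigcup_sup.
- have -> : (fun n : nat => nstep_set P n e (level n)) = (fun n => survival P e n e).
    by apply/funext => n; rewrite survival_level.
  have rs := return_survival S_countable Ptr X_chain.
  split=> [/(_ e)/rs //|cvg_e y]; apply/rs.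
  have [C [C0 HC]] := truncated_mean_return_bot S_chains P_up y.
  exact: survival_cvg0 HC cvg_e.
- split=> [/(_ e)//|mu_fin y].
  have [C [C0 HC]] := truncated_mean_return_bot S_chains P_up y.
  rewrite (mean_return_series S_countable Ptr X_chain).
  apply: (@le_lt_trans _ _ (C%:E * mu)).
    apply: lime_le.
      by apply: is_cvg_nneseries => n _ _; exact: survival_ge0.
    near=> N; rewrite big_mkord -truncated_meanE//.
    apply: (@le_trans _ _ (C%:E * (truncated_mean P e N e)%:E)).
      by rewrite -EFinM lee_fin.
    rewrite lee_wpmul2l ?lee_fin// truncated_meanE// mu_sum.
    rewrite -(big_mkord xpredT (fun n => survival P e n e)).
    by apply: nneseries_lim_ge => n _ _; exact: survival_ge0.
  by rewrite lte_mul_pinfty ?lee_fin.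
- move=> /(_ e); rewrite -/mu => mu_fin f.
  have mu1 : 1 <= mu.
    rewrite mu_sum; apply: le_trans (nneseries_lim_ge 1 _); last first.
      by move=> n _ _; exact: survival_ge0.
    by rewrite big_nat1 survival0.
  move: mu_fin mu1 muE; case: mu {mu_sum} => // m _ m1 mE.
  have m0 : (0 < m)%R by rewrite (lt_le_trans ltr01).
  have sumF : \esum_(x in [set: S]) hit_density P x = m%:E.
    by rewrite esum_hit_density.
  have divE (a : \bar R) : a / m%:E = a * (m^-1)%:E.
    by rewrite inver gt_eqF.
  split=> [finv n x <-|fE].
    by rewrite divE; exact: invariant_pdf_unique.
  apply: (invariant_pdf_density S_chains S_uniform P_up m0 sumF) => x.
  by rewrite -divE; exact: fE.
Unshelve. all: by end_near. Qed.
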